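(* If $N,n,r,s$ are positive integers with $n>3$, $1\le s\le 2r/3$ and $R_3(n;r,s)>N>0$, then $R_4(2n^2;r,s)>2^N$.
   Context: For positive integers $n,k,r,s$ with $n>k$ and $r>s$, an $(r,s)$-coloring of the complete $k$-uniform hypergraph $K_N^{(k)}$ is a map $\chi:E(K_N^{(k)})\to\binom{[r]}{s}$. A monochromatic $n$-clique is a set of $n$ vertices such that all $\binom{n}{k}$ edges within it contain a common color. $R_k(n;r,s)$ is the minimum $N$ such that every $(r,s)$-coloring of $K_N^{(k)}$ contains a monochromatic $n$-clique. *)

(* Defs.v *)
From mathcomp Require Import all_boot.

Set Implicit Arguments.
Unset Strict Implicit.
Unset Printing Implicit Defensive.

(* A coloring of the edges of K_N^(k) by subsets of [r] is a total map
   {set 'I_N} -> {set 'I_r}; only its values on sets of cardinality k, the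
   edges, are ever constrained or looked at. *)
Definition is_coloring (k r s N : nat) (chi : {ffun {set 'I_N} -> {set 'I_r}}) :
  bool :=
  [forall e : {set 'I_N}, (#|e| == k) ==> (#|chi e| == s)].

Definition mono_clique (k n r N : nat) (chi : {ffun {set 'I_N} -> {set 'I_r}})
    (S : {set 'I_N}) : bool :=
  (#|S| == n) &&
  [exists c : 'I_r, forall e : {set 'I_N},
     (e \subset S) && (#|e| == k) ==> (c \in chi e)].

Definition ramsey_prop (k n r s N : nat) : bool :=
  [forall chi : {ffun {set 'I_N} -> {set 'I_r}},
     is_coloring k s chi ==> [exists S, mono_clique k n chi S]].

Lemma sub_of_card (T : finType) (V : {set T}) (n : nat) :
  n <= #|V| -> exists2 S : {set T}, S \subset V & #|S| = n.
Proof.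
move=> /card_geqP[s [us szs sV]]; exists [set x in s].
  by apply/subsetP=> x; rewrite inE; apply: sV.
by rewrite cardsE (card_uniqP us).
Qed.

(* Ramsey's theorem for k-uniform hypergraphs with colors in C. *)
Lemma hypergraph_ramsey (C : finType) (c0 : C) (k n : nat) :
  exists N, forall (T : finType) (f : {set T} -> C) (V : {set T}),
    N <= #|V| ->
    exists (S : {set T}) (c : C), [/\ S \subset V, #|S| = n &
      forall e : {set T}, e \subset S -> #|e| = k -> f e = c].
Proof.
elim: k n => [|k IHk] n.
  exists n => T f V /sub_of_card[S SV cS]; exists S, (f set0); split=> // e _.
  by move/eqP; rewrite cards_eq0 => /eqP->.
have pre m : exists N, forall (T : finType) (f : {set T} -> C) (V : {set T}),
    N <= #|V| ->
    exists (S : {set T}) (d : T -> C), [/\ S \subset V, #|S| = m &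
      forall e : {set T}, e \subset S -> #|e| = k.+1 ->
        exists2 x, x \in e & f e = d x].
  elim: m => [|m [N IHm]].
    exists 0 => T f V _; exists set0, (fun=> c0).
    split; rewrite ?sub0set ?cards0 // => e.
    by rewrite subset0 => /eqP->; rewrite cards0.
  have [M HM] := IHk N; exists M.+1 => T f V leMV.
  have /card_gt0P[x xV] : 0 < #|V| by apply: leq_trans leMV.
  have leM : M <= #|V :\ x| by move: leMV; rewrite (cardsD1 x V) xV.
  have [S1 [c [S1V cS1 HS1]]] := HM T (fun e => f (x |: e)) _ leM.
  have [|S [d [SS1 cS HS]]] := IHm T f S1; first by rewrite cS1.
  have SVx := subset_trans SS1 S1V.
  have xS : x \notin S by apply/negP=> /(subsetP SVx); rewrite !inE eqxx.
  exists (x |: S), (fun y => if y == x then c else d y); split.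
  - by rewrite subUset sub1set xV (subset_trans SVx) ?subD1set.
  - by rewrite cardsU1 xS cS.
  move=> e eS ce; have [xe|xe] := boolP (x \in e).
    exists x => //; rewrite eqxx -(HS1 (e :\ x)) ?setD1K //.
      by apply: subset_trans SS1; rewrite subDset.
    by move: ce; rewrite (cardsD1 x e) xe => -[].
  have eS' : e \subset S.
    apply/subsetP=> y ye; move/subsetP/(_ y ye): eS; rewrite !inE.
    by case: eqP => // yx; rewrite -yx ye in xe.
  have [y ye fe] := HS e eS' ce; exists y => //.
  by case: eqP => // yx; rewrite -yx ye in xe.
have [N HN] := pre (#|C| * n).+1; exists N => T f V /HN{HN}-/(_ f)[S [d]].
case=> SV cS HS.
have [/existsP[c lec]|/existsPn small] :=
    boolP [exists c, n <= #|[set x in S | d x == c]|].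
  have [S' S'S cS'] := sub_of_card lec; exists S', c; split=> //.
    by apply: subset_trans S'S _; apply/subsetP=> x; rewrite inE => /andP[/(subsetP SV)].
  move=> e eS' ce; have [|x xe ->] := HS e _ ce.
    apply: subset_trans eS' (subset_trans S'S _).
    by apply/subsetP=> x; rewrite inE => /andP[].
  by move/subsetP/(_ x xe): eS' => /(subsetP S'S); rewrite inE => /andP[_ /eqP].
have : #|S| <= #|C| * n.
  rewrite -sum1_card (partition_big d xpredT) //= -sum_nat_const leq_sum // => c _.
  apply: ltnW; rewrite ltnNge; apply: contra (small c).
  by rewrite sum1dep_card.
by rewrite cS ltnn.
Qed.

Lemma ramsey_prop_ex (k n r s : nat) : 0 < s -> exists N, ramsey_prop k n r s N.
Proof.
case: r => [|r] s0.
  exists k; apply/forallP=> chi; apply/implyP=> /forallP/(_ setT).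
  rewrite cardsT card_ord eqxx /= => /eqP cs; move: s0.
  by rewrite -cs ltnNge (leq_trans (max_card _)) ?card_ord.
have [N HN] := hypergraph_ramsey (@ord0 r) k n; exists N.
apply/forallP=> chi; apply/implyP=> /forallP col.
have := HN _ (fun e => odflt ord0 [pick c in chi e]) [set: 'I_N].
rewrite cardsT card_ord => /(_ (leqnn _))[S [c [_ cS HS]]].
apply/existsP; exists S; rewrite /mono_clique cS eqxx; apply/existsP; exists c.
apply/forallP=> e; apply/implyP=> /andP[eS /eqP ce]; rewrite -(HS e eS ce).
case: pickP => //= none; move: (col e); rewrite ce eqxx /= => /eqP cs.
by rewrite -cs (eq_card0 none) in s0.
Qed.

(* R_k(n; r, s). For s = 0 no edge has a color and the minimum need not exist;
   the value is then 0 by convention. *)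
Definition ramsey (k n r s : nat) : nat :=
  if @idP (0 < s) is ReflectT s_gt0 then ex_minn (ramsey_prop_ex k n r s_gt0)
  else 0.

Lemma ramseyP (k n r s : nat) : 0 < s ->
  ramsey_prop k n r s (ramsey k n r s) /\
  forall N, ramsey_prop k n r s N -> ramsey k n r s <= N.
Proof.
by rewrite /ramsey; case: {-}_ / idP => // s_gt0 _; case: ex_minnP.
Qed.

(* Main.v *)
Require Import Defs.
From mathcomp Require Import all_boot.
From mathcomp Require Import zify.

(** Step-up on the binary expansions.  Vertices are numbers below [2 ^ N], and
  [delta x y] is the position of the highest binary digit in which [x] and [y]
  differ, so a set of vertices is the set of leaves of a binary tree whose
  branchings are labelled by [delta].  A 4-tuple [a < b < c < d] spans one of
  five shapes: two combs, [((ab)c)d] and [a(b(cd))], whose three labels are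
  distinct and inherit their color from the 3-uniform coloring, and
  [(ab)(cd)], [(a(bc))d], [a((bc)d)], which get three fixed [s]-sets with empty
  common intersection; these exist because [3 s <= 2 r].  A color of a
  monochromatic clique is absent from one of these three sets, so the clique
  avoids one of the three shapes; but a leaf has fewer than [n] labels at which
  its path turns left, and fewer than [n] at which it turns right.  A tree
  without [(ab)(cd)] is a caterpillar and has at most [2 n] leaves, and one
  without [a((bc)d)] consists of right combs hanging from a left comb and has at
  most [n ^ 2] leaves. *)

Set Implicit Arguments.
Unset Strict Implicit.
Unset Printing Implicit Defensive.

(** * Edges as increasing tuples of vertices *)

Lemma sorted_enum_set (M : nat) (e : {set 'I_M}) :
  sorted ltn (map val (enum e)).
Proof.
apply: (subseq_sorted ltn_trans (s2 := map val (enum 'I_M))).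
  by rewrite enumT; apply/map_subseq/filter_subseq.
by rewrite val_enum_ord iota_ltn_sorted.
Qed.

Lemma enum_set_sorted (M : nat) (s : seq 'I_M) :
  sorted ltn (map val s) -> enum [set x in s] = s.
Proof.
move=> srt; apply: (inj_map val_inj).
apply: (irr_sorted_eq ltn_trans ltnn) => //; first exact: sorted_enum_set.
move=> i; apply/mapP/mapP=> -[x xs ->]; exists x => //.
  by rewrite mem_enum inE in xs.
by rewrite mem_enum inE.
Qed.

Lemma enum_set4 (M : nat) (a b c d : 'I_M) :
  a < b -> b < c -> c < d -> enum [set a; b; c; d] = [:: a; b; c; d].
Proof.
move=> ab bc cd; rewrite -[RHS]enum_set_sorted /= ?ab ?bc ?cd //.
by apply: eq_enum => x; rewrite !inE -!orbA.
Qed.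

Lemma card3_sorted (M : nat) (e : {set 'I_M}) :
  #|e| = 3 -> exists a b c : 'I_M, [/\ a < b, b < c & e = [set a; b; c]].
Proof.
move=> ce; have := sorted_enum_set e; have := esym (set_enum e).
move: ce; rewrite cardE; case: (enum e) => [|a [|b [|c [|? ?]]]] //= _ eE.
case/and3P=> ab bc _; exists a, b, c; split=> //.
by rewrite eE; apply/setP=> x; rewrite !inE orbA.
Qed.

Lemma card_set3_lt (M : nat) (a b c : 'I_M) :
  a < b -> b < c -> #|[set a; b; c]| = 3.
Proof.
move=> ab bc; rewrite setUC cardsU1 cards2 !inE -!val_eqE /=.
by have := ltn_trans ab bc; lia.
Qed.

Lemma card_set4_lt (M : nat) (a b c d : 'I_M) :
  a < b -> b < c -> c < d -> #|[set a; b; c; d]| = 4.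
Proof. by move=> ab bc cd; rewrite cardE enum_set4. Qed.

(** * Three color sets with empty intersection *)

Lemma ord_interval (r a t : nat) : a + t <= r ->
  exists2 B : {set 'I_r}, #|B| = t & forall i : 'I_r, a <= i < a + t -> i \in B.
Proof.
move=> le_r.
have lt_r (i : 'I_t) : a + i < r by apply: leq_trans le_r; rewrite ltn_add2l.
exists [set Ordinal (lt_r i) | i in setT].
  rewrite card_imset ?cardsT ?card_ord // => i j [] /addnI ij.
  exact: val_inj.
move=> i /andP[ai it]; have lt_t : i - a < t by lia.
apply/imsetP; exists (Ordinal lt_t); rewrite ?inE //.
by apply: val_inj => /=; lia.
Qed.

(** Complements of three intervals of length [r - s], which can cover [[r]] since
    [3 * (r - s) >= r]. The [minn] keeps the middle interval inside [[r]]. *)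
Lemma three_sets_no_common (r s : nat) : 3 * s <= 2 * r ->
  exists A1 A2 A3 : {set 'I_r}, [/\ #|A1| = s, #|A2| = s, #|A3| = s &
    forall c, [|| c \notin A1, c \notin A2 | c \notin A3]].
Proof.
move=> hs; have cardC (B : {set 'I_r}) : #|B| = r - s -> #|~: B| = s.
  by move=> cB; rewrite cardsCs setCK card_ord cB; lia.
have [|B1 c1 in1] := @ord_interval r 0 (r - s); first lia.
have [|B2 c2 in2] := @ord_interval r (minn (r - s) s) (r - s); first lia.
have [|B3 c3 in3] := @ord_interval r s (r - s); first lia.
exists (~: B1), (~: B2), (~: B3); split; try exact: cardC.
move=> c; rewrite !inE !negbK; have lt_c := ltn_ord c.
have [lt1|ge1] := ltnP c (r - s); first by rewrite in1.
have [lt3|ge3] := ltnP c s; last by rewrite in3 ?orbT //; lia.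
by rewrite in2 ?orbT //; lia.
Qed.

(** * Labelled binary trees and their leaves *)

(* The labelling of the branchings of an ordered binary tree with leaves [T],
   [rho] giving the left-to-right order. *)
Definition tree_labelling (T : Type) (rho : T -> nat) (delta : T -> T -> nat) :=
  forall x y z, rho x < rho y -> rho y < rho z ->
  delta x y != delta y z /\ delta x z = maxn (delta x y) (delta y z).

Section Trees.

Variables (T : finType) (D : nat).
Implicit Types (rho : T -> nat) (delta : T -> T -> 'I_D) (S : {set T}).

Lemma tree_labelling_rev rho rho' delta :
  (forall x y, delta x y = delta y x) ->
  (forall x y, (rho' x < rho' y) = (rho y < rho x)) ->
  tree_labelling rho delta -> tree_labelling rho' delta.
Proof.
move=> sym rev tree x y z; rewrite !rev => yx zy.
have [ne mx] := tree _ _ _ zy yx.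
by rewrite ![delta x _]sym (sym y z) eq_sym maxnC.
Qed.

(** The leaf [x] leaves the path to [z] above [y]. If [y] were left of [x], the label of [y] and [z]
    would be a maximum involving [delta x z]. *)
Lemma lt_of_label_lt rho delta : injective rho -> tree_labelling rho delta ->
  forall x y z, rho x < rho z -> rho y < rho z -> delta y z < delta x z ->
  rho x < rho y /\ delta x y = delta x z :> nat.
Proof.
move=> inj tree x y z xz yz dlt.
case: (ltngtP (rho x) (rho y)) => [xy|yx|/inj xy].
- by split=> //; have [_ mx] := tree _ _ _ xy yz; lia.
- by have [_ mx] := tree _ _ _ yx xz; lia.
- by rewrite xy ltnn in dlt.
Qed.

(** The labels at which a subtree hangs off the path to [z] on its left; a reversed [rho] gives
    those on its right. *)
Definition left_labels rho delta S z :=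
  [set delta x z | x in S & rho x < rho z].

(* Choosing for every label a leaf branching off the path to [z] there, one
   gets together with [z] a comb. *)
Lemma card_left_labels rho delta S z (n r : nat)
    (chi : {ffun {set 'I_D} -> {set 'I_r}}) (c : 'I_r) :
  injective rho -> tree_labelling rho delta ->
  (forall V, ~~ mono_clique 3 n chi V) ->
  (forall x1 x2 x3, x1 \in S -> x2 \in S -> x3 \in S ->
     rho x1 < rho x2 -> rho x2 < rho x3 -> rho x3 < rho z ->
     delta x2 x3 < delta x1 x2 -> delta x3 z < delta x2 x3 ->
     c \in chi [set delta x3 z; delta x2 x3; delta x1 x2]) ->
  #|left_labels rho delta S z| < n.
Proof.
move=> inj tree nomono comb; rewrite ltnNge; apply/negP=> /sub_of_card[V sV cV].
case/negP: (nomono V); rewrite /mono_clique cV eqxx; apply/existsP; exists c.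
apply/forallP=> e; apply/implyP=> /andP[eV /eqP ce].
have [d3 [d2 [d1 [d32 d21 eE]]]] := card3_sorted ce.
have rep d : d \in e -> exists x, [/\ x \in S, rho x < rho z & d = delta x z].
  move=> /(subsetP eV)/(subsetP sV)/imsetP[x].
  by rewrite inE => /andP[xS xz] ->; exists x.
have [|x1 [x1S x1z d1E]] := rep d1; first by rewrite eE !inE eqxx ?orbT.
have [|x2 [x2S x2z d2E]] := rep d2; first by rewrite eE !inE eqxx ?orbT.
have [|x3 [x3S x3z d3E]] := rep d3; first by rewrite eE !inE eqxx ?orbT.
rewrite {}eE; move: d32 d21; rewrite {}d1E {}d2E {}d3E => d32 d21.
have [x12 e12] := lt_of_label_lt inj tree x1z x2z d21.
have [x23 e23] := lt_of_label_lt inj tree x2z x3z d32.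
rewrite -(val_inj e12) -(val_inj e23); apply: comb => //.
  by rewrite e12 e23.
by rewrite e23.
Qed.

(* A set of leaves without a [(ab)(cd)] is a caterpillar: every branching on the
   path to a lowest leaf [z] cuts off a single leaf. *)
Lemma caterpillar_inj rho delta S z w : injective rho ->
  tree_labelling rho delta -> (forall x y, delta x y = delta y x) ->
  (forall a b c d, a \in S -> b \in S -> c \in S -> d \in S ->
     rho a < rho b -> rho b < rho c -> rho c < rho d ->
     ~ (delta a b < delta b c /\ delta c d < delta b c)) ->
  z \in S -> w \in S -> z != w ->
  {in S &, forall x y, x != y -> delta z w <= delta x y} ->
  {in [set x in S | rho x < rho z] &, injective (delta^~ z)}.
Proof.
move=> inj tree sym nobal zS wS zw minzw.
have main x y : x \in S -> y \in S -> rho y < rho z -> delta x z = delta y z ->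
    ~ rho x < rho y.
  move=> xS yS yz exy xy; have [ne mx] := tree _ _ _ xy yz.
  have lxy : delta x y < delta y z by move/(congr1 val): exy => /=; lia.
  have : delta z w <= delta x y.
    by apply: minzw => //; apply/eqP=> xy'; rewrite xy' ltnn in xy.
  (* The leaf [w] is too close to [z] to lie at or left of [y], so [x], [y] and the pair [z], [w]
     form a forbidden [(ab)(cd)]. *)
  move=> lzw; case: (ltngtP (rho z) (rho w)) => [zw'|wz|/inj zw']; last first.
  - by rewrite zw' eqxx in zw.
  - case: (ltngtP (rho y) (rho w)) => [yw|wy|/inj yw]; last first.
    + by move: lzw; rewrite sym -yw; lia.
    + by have [_ mw] := tree _ _ _ wy yz; rewrite sym in lzw; lia.
    have [_ mw] := tree _ _ _ yw wz.
    apply: (nobal x y w z) => //; rewrite (sym w z).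
    by rewrite (sym w z) in mw; lia.
  by apply: (nobal x y z w) => //; lia.
move=> x y; rewrite !inE => /andP[xS xz] /andP[yS yz] exy; apply: inj.
case: (ltngtP (rho x) (rho y)) => // [xy|yx].
  by case: (main x y).
by case: (main y x).
Qed.

(** With [z], [w] a pair of least label, any other leaf is determined by its side of [z] and its
    label with [z], so there are at most [1 + 2 * (n - 1)] leaves. *)
Lemma card_caterpillar rho rho' delta S n : injective rho -> injective rho' ->
  (forall x y, (rho' x < rho' y) = (rho y < rho x)) ->
  tree_labelling rho delta -> (forall x y, delta x y = delta y x) ->
  (forall a b c d, a \in S -> b \in S -> c \in S -> d \in S ->
     rho a < rho b -> rho b < rho c -> rho c < rho d ->
     ~ (delta a b < delta b c /\ delta c d < delta b c)) ->
  {in S, forall z, #|left_labels rho delta S z| < n} ->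
  {in S, forall z, #|left_labels rho' delta S z| < n} ->
  0 < n -> #|S| < 2 * n.
Proof.
move=> inj inj' rev tree sym nobal left right n0.
have [|/card_gt1P[x0 [y0 [x0S y0S ne0]]]] := leqP #|S| 1; first lia.
pose P := [pred p : T * T | [&& p.1 \in S, p.2 \in S & p.1 != p.2]].
have P0 : P (x0, y0) by apply/and3P.
case: (@arg_minnP _ (x0, y0) P (fun p => delta p.1 p.2) P0) => -[z w].
move=> /and3P[/= zS wS zw] minp.
have minzw : {in S &, forall x y, x != y -> delta z w <= delta x y}.
  by move=> x y xS yS xy; apply: (minp (x, y)); apply/and3P.
have il := caterpillar_inj inj tree sym nobal zS wS zw minzw.
have ir : {in [set x in S | rho' x < rho' z] &, injective (delta^~ z)}.
  apply: (caterpillar_inj inj' (tree_labelling_rev sym rev tree) sym _ zS wS zw)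
    => // a b c d aS bS cS dS; rewrite !rev => ba cb dc [l1 l2].
  by apply: (nobal d c b a) => //; rewrite (sym d c) (sym c b) (sym b a).
have := left z zS; have := right z zS.
rewrite /left_labels !card_in_imset //.
suff : #|S| <= 1 + (#|[set x in S | rho x < rho z]| +
                    #|[set x in S | rho' x < rho' z]|) by lia.
rewrite -(cards1 z) (leq_trans _ (leq_add (leqnn _) (leq_card_setU _ _))) //.
rewrite (leq_trans _ (leq_card_setU _ _)) // subset_leq_card //.
apply/subsetP=> x xS; rewrite !inE xS rev /=.
by case: (ltngtP (rho x) (rho z)) => [//|//|/inj->]; rewrite ?eqxx ?orbT.
Qed.

(* Without [a((bc)d)], the leaves that leave the path to the leftmost leaf at a
   given label form a right comb. *)
Lemma card_no_zigzag rho rho' delta S n : injective rho -> injective rho' ->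
  (forall x y, (rho' x < rho' y) = (rho y < rho x)) ->
  tree_labelling rho delta -> (forall x y, delta x y = delta y x) ->
  (forall a b c d, a \in S -> b \in S -> c \in S -> d \in S ->
     rho a < rho b -> rho b < rho c -> rho c < rho d ->
     ~ (delta b c < delta c d /\ delta c d < delta a b)) ->
  {in S, forall z, #|left_labels rho delta S z| < n} ->
  {in S, forall z, #|left_labels rho' delta S z| < n} ->
  0 < n -> #|S| < 2 * n ^ 2.
Proof.
move=> inj inj' rev tree sym nozig left right n0.
have [->|[x0 x0S]] := set_0Vmem S; first by rewrite cards0 muln_gt0 expn_gt0 n0.
case: (@arg_minnP _ x0 [in S] rho x0S) => z /= zS minz.
have zlt x : x \in S -> x != z -> rho z < rho x.
  move=> xS xz; rewrite ltn_neqAle minz // andbT.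
  by apply: contraNneq xz => /inj->.
pose cls j := [set x in S :\ z | delta x z == j].
have card_cls j : #|cls j| <= n.
  have [->|[y0 y0C]] := set_0Vmem (cls j); first by rewrite cards0.
  case: (@arg_maxnP _ y0 [in cls j] rho y0C) => m /= mC maxm.
  move: (mC); rewrite !inE => /andP[/andP[mz mS] /eqP mj].
  rewrite (cardsD1 m) mC add1n; apply: leq_ltn_trans (left m mS).
  rewrite /left_labels -(card_in_imset (f := delta^~ m)); last first.
    (* Equal labels with the rightmost leaf [m] of the class would make [z], [x], [y], [m] an
       [a((bc)d)]. *)
    have main x y : x \in cls j -> y \in cls j -> rho y < rho m ->
        delta x m = delta y m -> ~ rho x < rho y.
      rewrite !inE => /andP[/andP[xz xS] /eqP xj] /andP[/andP[yz yS] _].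
      move=> ym exy xy.
      have [ne mx] := tree _ _ _ xy ym.
      have zx := zlt x xS xz.
      have [ne' mx'] := tree _ _ _ zx (ltn_trans xy ym).
      apply: (nozig z x y m) => //.
      move/(congr1 val): exy => /= exy.
      rewrite (sym z x) (sym z m) xj mj in ne' mx' *; lia.
    have mlt x : x \in cls j :\ m -> rho x < rho m.
      rewrite in_setD1 => /andP[xm xC].
      rewrite ltn_neqAle maxm // andbT.
      by apply: contraNneq xm => /inj->.
    move=> x y xC yC exy; apply: inj.
    have := mlt x xC; have := mlt y yC.
    move: xC yC; rewrite !in_setD1 => /andP[_ xC] /andP[_ yC] ym xm.
    case: (ltngtP (rho x) (rho y)) => // [xy|yx].
      by case: (main x y).
    by case: (main y x).
  apply/subset_leq_card/imsetS/subsetP=> x; rewrite in_setD1 => /andP[xm xC].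
  move: (xC); rewrite !inE => /andP[/andP[_ ->] _] /=.
  rewrite ltn_neqAle maxm // andbT.
  by apply: contraNneq xm => /inj->.
(* At most [n - 1] labels occur on the path to [z], each with a class of at most [n] leaves. *)
suff : #|S :\ z| <= n.-1 * n by rewrite (cardsD1 z S) zS -mulnn; nia.
rewrite -sum1_card.
pose L := left_labels rho' delta S z.
rewrite (partition_big (delta^~ z) [in L]) /=; last first.
  move=> x xSz; apply/imsetP; exists x => //.
  by move: xSz; rewrite !inE rev => /andP[xz xS]; rewrite xS zlt.
apply: leq_trans (_ : \sum_(j in L) n <= _).
  apply: leq_sum => j _; rewrite sum1dep_card; apply: leq_trans (card_cls j).
  by rewrite subset_leq_card //; apply/subsetP=> x; rewrite !inE.
by rewrite sum_nat_const leq_mul2r -ltnS prednK ?right ?orbT.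
Qed.

End Trees.

(** * The highest differing binary digit *)

Section HighestDigit.

Variables (N' M : nat).
Hypothesis leM : M <= 2 ^ N'.+1.
Implicit Types x y z : 'I_M.

(** Dividing by [2 ^ j.+1] drops the digits up to [j]. The default [ord_max] qualifies once all
    vertices are below [2 ^ N'.+1]; equal vertices get 0. *)
Definition top_digit (x y : 'I_M) : 'I_N'.+1 :=
  [arg min_(j < ord_max | x %/ 2 ^ j.+1 == y %/ 2 ^ j.+1) j].

Lemma top_digit_le x y (j : 'I_N'.+1) :
  (top_digit x y <= j) = (x %/ 2 ^ j.+1 == y %/ 2 ^ j.+1).
Proof.
rewrite /top_digit; case: arg_minnP => [|i /eqP ei min].
  by rewrite !divn_small // (leq_trans (ltn_ord _)).
apply/idP/eqP => [/= ij|/eqP/min//].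
have -> : j.+1 = i.+1 + (j - i) by lia.
by rewrite expnD !divnMA ei.
Qed.

Lemma top_digit_sym x y : top_digit x y = top_digit y x.
Proof.
apply: val_inj; apply/eqP; rewrite eqn_leq !top_digit_le.
by rewrite eq_sym -top_digit_le leqnn eq_sym -top_digit_le leqnn.
Qed.

Lemma top_digit_parity x y : x < y ->
  odd (x %/ 2 ^ top_digit x y) = false /\ odd (y %/ 2 ^ top_digit x y) = true.
Proof.
set j := top_digit x y => xy.
have : x %/ 2 ^ j.+1 == y %/ 2 ^ j.+1 by rewrite -top_digit_le.
have : x %/ 2 ^ j < y %/ 2 ^ j.
  rewrite ltn_neqAle leq_div2r ?(ltnW xy) // andbT.
  case ej: (nat_of_ord j) => [|i]; first by rewrite !divn1 ltn_eqF.
  have lti : i < N'.+1 by apply: ltnW; rewrite -ej ltn_ord.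
  by rewrite -(top_digit_le x y (Ordinal lti)) -/j ej ltnn.
rewrite expnSr !divnMA !divn2 => lt /eqP eq_half.
move: lt; rewrite -[in X in X < _](odd_double_half (x %/ 2 ^ j)).
rewrite -[in X in _ < X](odd_double_half (y %/ 2 ^ j)) eq_half ltn_add2r.
by case: odd; case: odd.
Qed.

(** Equal consecutive labels would force the digit of [y] there to be both 1 and 0. For the maximum,
    the prefix of [y] is squeezed between those of [x] and [z]. *)
Lemma top_digit_tree : tree_labelling (@nat_of_ord M) top_digit.
Proof.
move=> x y z xy yz; split.
  apply/eqP=> e; have [_] := top_digit_parity xy.
  by have [+ _] := top_digit_parity yz; rewrite -e => ->.
have le_max (j : 'I_N'.+1) :
    (top_digit x z <= j) = (maxn (top_digit x y) (top_digit y z) <= j).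
  rewrite geq_max !top_digit_le; apply/eqP/andP => [e|[/eqP-> /eqP->]//].
  have := leq_div2r (2 ^ j.+1) (ltnW xy).
  have := leq_div2r (2 ^ j.+1) (ltnW yz).
  by rewrite e => le1 le2; split; rewrite eqn_leq ?le1 ?le2.
have := le_max (top_digit x z); have := le_max (top_digit x y).
have := le_max (top_digit y z); lia.
Qed.

End HighestDigit.

(** * The stepped-up coloring and its cliques *)

(** On consecutive labels of a 4-tuple, the branches are the two combs, then [(ab)(cd)], [(a(bc))d]
    and [a((bc)d)]. *)
Definition step_up_color (D r : nat) (chi : {ffun {set 'I_D} -> {set 'I_r}})
    (A1 A2 A3 : {set 'I_r}) (d1 d2 d3 : 'I_D) : {set 'I_r} :=
  if d1 < d2 < d3 then chi [set d1; d2; d3]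
  else if d3 < d2 < d1 then chi [set d3; d2; d1]
  else if d1 < d2 then A1 else if d1 < d3 then A2 else A3.

Definition step_up (D r M : nat) (delta : 'I_M -> 'I_M -> 'I_D)
    (chi : {ffun {set 'I_D} -> {set 'I_r}}) (A1 A2 A3 : {set 'I_r}) :
    {ffun {set 'I_M} -> {set 'I_r}} :=
  [ffun e : {set 'I_M} => if enum e is [:: a; b; c; d]
             then step_up_color chi A1 A2 A3 (delta a b) (delta b c) (delta c d)
             else set0].

Lemma is_coloring_step_up (D r s M : nat) (delta : 'I_M -> 'I_M -> 'I_D)
    (chi : {ffun {set 'I_D} -> {set 'I_r}}) (A1 A2 A3 : {set 'I_r}) :
  is_coloring 3 s chi -> #|A1| = s -> #|A2| = s -> #|A3| = s ->
  is_coloring 4 s (step_up delta chi A1 A2 A3).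
Proof.
move=> /forallP col c1 c2 c3; apply/forallP=> e; apply/implyP.
rewrite ffunE cardE; case: (enum e) => [|a [|b [|c [|d [|? ?]]]]] //= _.
rewrite /step_up_color.
case: ifP => [/andP[lt1 lt2]|_].
  by apply: (implyP (col _)); rewrite card_set3_lt.
case: ifP => [/andP[lt1 lt2]|_].
  by apply: (implyP (col _)); rewrite card_set3_lt.
by case: ifP => _; [rewrite c1|case: ifP => _; rewrite ?c2 ?c3].
Qed.

Lemma card_clique_step_up (D r M n : nat) (delta : 'I_M -> 'I_M -> 'I_D)
    (chi : {ffun {set 'I_D} -> {set 'I_r}}) (A1 A2 A3 : {set 'I_r})
    (S : {set 'I_M}) (c : 'I_r) : 0 < n ->
  tree_labelling (@nat_of_ord M) delta ->
  (forall x y, delta x y = delta y x) ->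
  (forall V, ~~ mono_clique 3 n chi V) ->
  [|| c \notin A1, c \notin A2 | c \notin A3] ->
  (forall e : {set 'I_M}, e \subset S -> #|e| = 4 ->
     c \in step_up delta chi A1 A2 A3 e) ->
  #|S| < 2 * n ^ 2.
Proof.
move=> n0 tree sym nomono cA mono.
have quad x y z t : x \in S -> y \in S -> z \in S -> t \in S ->
    x < y -> y < z -> z < t ->
    c \in step_up_color chi A1 A2 A3 (delta x y) (delta y z) (delta z t).
  move=> xS yS zS tS xy yz zt.
  have := mono [set x; y; z; t].
  rewrite ffunE enum_set4 ?card_set4_lt //; apply=> //.
  by rewrite !subUset !sub1set xS yS zS.
(* The reversed order [rho'] turns statements about left turns into ones about right turns. *)
pose rho (x : 'I_M) : nat := x; pose rho' (x : 'I_M) := M - x.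
have inj : injective rho by exact: val_inj.
have rev x y : (rho' x < rho' y) = (rho y < rho x).
  by rewrite /rho /rho'; have := ltn_ord x; have := ltn_ord y; lia.
have rev' x y : (rho x < rho y) = (rho' y < rho' x) by rewrite rev.
have inj' : injective rho'.
  move=> x y; rewrite /rho' => e; apply: val_inj => /=.
  by have := ltn_ord x; have := ltn_ord y; lia.
have tree' := tree_labelling_rev sym rev tree.
have left : {in S, forall z, #|left_labels rho delta S z| < n}.
  move=> z zS; apply: (card_left_labels (c := c) inj tree nomono).
  move=> x1 x2 x3 x1S x2S x3S x12 x23 x3z d21 d32.
  have := quad x1 x2 x3 z x1S x2S x3S zS x12 x23 x3z.
  by rewrite /step_up_color d21 d32 ltnNge (ltnW d21).
have right : {in S, forall z, #|left_labels rho' delta S z| < n}.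
  move=> z zS; apply: (card_left_labels (c := c) inj' tree' nomono).
  move=> x1 x2 x3 x1S x2S x3S; rewrite !rev => x12 x23 x3z d21 d32.
  have := quad z x3 x2 x1 zS x3S x2S x1S x3z x23 x12.
  by rewrite /step_up_color (sym z x3) (sym x3 x2) (sym x2 x1) d32 d21.
case/or3P: cA => cA.
- apply: leq_trans (_ : 2 * n <= _); last by rewrite -mulnn; nia.
  apply: (card_caterpillar inj inj' rev tree sym _ left right n0).
  move=> x y z t xS yS zS tS xy yz zt [lt1 lt2].
  have := quad x y z t xS yS zS tS xy yz zt.
  rewrite /step_up_color lt1 [_ < delta z t]ltnNge (ltnW lt2) /=.
  by rewrite [delta y z < _]ltnNge (ltnW lt1) andbF (negPf cA).
(* The shape [(a(bc))d] is the mirror image of [a((bc)d)], so the two orders are exchanged. *)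
- apply: (card_no_zigzag inj' inj rev' tree' sym _ right left n0).
  move=> x y z t xS yS zS tS; rewrite !rev => yx zy tz [lt1 lt2].
  have := quad t z y x tS zS yS xS tz zy yx.
  rewrite /step_up_color (sym t z) (sym z y) (sym y x).
  have -> : (delta z t < delta y z) = false by lia.
  have -> : (delta x y < delta y z) = false by lia.
  by rewrite lt2 (negPf cA).
apply: (card_no_zigzag inj inj' rev tree sym _ left right n0).
move=> x y z t xS yS zS tS xy yz zt [lt1 lt2].
have := quad x y z t xS yS zS tS xy yz zt.
rewrite /step_up_color.
have -> : (delta x y < delta y z) = false by lia.
have -> : (delta z t < delta y z) = false by lia.
have -> : (delta x y < delta z t) = false by lia.
by rewrite (negPf cA).
Qed.

Theorem theorem5p4 (N n r s : nat) (hN : 0 < N) (hn : 3 < n) (hr : 0 < r)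
  (hs : 1 <= s) (hsr : 3 * s <= 2 * r) (hR : N < ramsey 3 n r s) :
  2 ^ N < ramsey 4 (2 * n ^ 2) r s.
Proof.
have [_ min3] := ramseyP 3 n r hs.
have [prop4 _] := ramseyP 4 (2 * n ^ 2) r hs.
(* If [M], the Ramsey number, were at most [2 ^ N], its vertices would have [N] binary digits, and a
   coloring on these digits could be stepped up. *)
rewrite ltnNge; apply/negP; move: (ramsey _ _ _ _) prop4 => M prop4 leM.
have : ~~ ramsey_prop 3 n r s N.
  by apply: contraL hR => /min3; rewrite -leqNgt.
case/forallPn=> chi; rewrite negb_imply => /andP[col /existsPn nomono].
have [A1 [A2 [A3 [c1 c2 c3 cA]]]] := three_sets_no_common hsr.
case: N hN leM chi col nomono {hR} => // N' _ leM chi col nomono.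
pose psi := step_up (@top_digit N' M) chi A1 A2 A3.
have /(implyP (forallP prop4 psi))/existsP[S] : is_coloring 4 s psi.
  exact: is_coloring_step_up.
case/andP=> /eqP cS /existsP[c /forallP mono].
suff : #|S| < 2 * n ^ 2 by rewrite cS ltnn.
apply: (card_clique_step_up (c := c) _ (top_digit_tree leM) (top_digit_sym leM)
  nomono (cA c)) => [|e eS ce]; first by apply: leq_trans hn.
by apply: (implyP (mono e)); rewrite eS ce.
Qed.
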